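(* Let $c_T:\mathbb{R}^d\times\mathbb{S}\to\mathbb{R}$ be bounded and globally Lipschitz in $x$ (uniformly in $i$), with $c_T\in W^{2,p}_{\mathrm{loc}}(\mathbb{R}^d\times\mathbb{S})$ for some $p\ge2$. Let $\mathcal{K}\subset\mathbb{R}^d$ be compact and let $\mathcal{M}^{\mathcal{K}}=(\mathcal{K}\times\mathbb{S},\mathbb{U},p_{\mathcal{K}},c_{\mathcal{K}})$ be a compact-state Markov decision process with weakly continuous transition kernel $p_{\mathcal{K}}$, continuous one-stage cost $c_{\mathcal{K}}\ge0$, terminal cost $c_T$ and horizon $K\in\mathbb{N}$, with finite-horizon value functions $\bar{\mathcal{J}}_k$. Let $\widehat{\mathcal{M}}^{\mathcal{K}}_n$ be its finite-state approximations, with value functions $\hat{\mathcal{J}}^n_k$ extended to $\mathcal{K}\times\mathbb{S}$ by $\hat{\mathcal{J}}^n_k(x,i)=\hat{\mathcal{J}}^n_k(\mathcal{Q}_n(x),i)$. Then for each $k\in\{0,\dots,K\}$ $$\sup_{(x,i)\in\mathcal{K}\times\mathbb{S}}|\bar{\mathcal{J}}_k(x,i)-\hat{\mathcal{J}}^n_k(x,i)|\to0\qquad\text{as }n\to\infty.$$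
   Context: $\mathbb{U}$ is a compact metric space (actions), $\mathbb{S}=\{1,\dots,N\}$. Compact-state MDP $\mathcal{M}^{\mathcal{K}}$: $p_{\mathcal{K}}(\cdot,\cdot\mid x,i,\zeta)$ is a transition kernel on $\mathcal{K}\times\mathbb{S}$ given $(x,i,\zeta)\in\mathcal{K}\times\mathbb{S}\times\mathbb{U}$, weakly continuous in $(x,\zeta)$ (i.e. $(x_m,\zeta_m)\to(x,\zeta)$ implies $p_{\mathcal{K}}(\cdot,\cdot\mid x_m,i,\zeta_m)\to p_{\mathcal{K}}(\cdot,\cdot\mid x,i,\zeta)$ weakly), and $c_{\mathcal{K}}:\mathcal{K}\times\mathbb{S}\times\mathbb{U}\to[0,\infty)$ is continuous. Its value functions are $\bar{\mathcal{J}}_K=c_T$ and, for $k=K-1,\dots,0$, $$\bar{\mathcal{J}}_k(x,i)=\min_{\zeta\in\mathbb{U}}\Big[c_{\mathcal{K}}(x,i,\zeta)+\int_{\mathcal{K}\times\mathbb{S}}\bar{\mathcal{J}}_{k+1}(y,j)\,p_{\mathcal{K}}(dy,dj\mid x,i,\zeta)\Big].$$ Quantization: for each $n\in\mathbb{N}$, $\Lambda_n=\{z_{n,l}\}_{l=1}^{l_n}\subset\mathcal{K}$ is a finite set with $\min_l|z-z_{n,l}|<1/n$ for all $z\in\mathcal{K}$; $\mathcal{Q}_n:\mathcal{K}\to\Lambda_n$ maps $z$ to a nearest grid point (ties broken by smallest index); $\mathcal{S}_{n,l}=\{z\in\mathcal{K}:\mathcal{Q}_n(z)=z_{n,l}\}$;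 $\nu_n$ is a probability measure on $\mathcal{K}$ with $\nu_n(\mathcal{S}_{n,l})>0$ for all $l$, and $\nu_{n,l}(\cdot)=\nu_n(\cdot)/\nu_n(\mathcal{S}_{n,l})$ on $\mathcal{S}_{n,l}$. Finite-state model $\widehat{\mathcal{M}}^{\mathcal{K}}_n$: state space $\Lambda_n\times\mathbb{S}$, actions $\mathbb{U}$, kernel $p_n(y,j\mid z_{n,l},i,\zeta)=\int_{\mathcal{S}_{n,l}}p_{\mathcal{K}}(\mathcal{Q}_n^{-1}(y),j\mid z,i,\zeta)\nu_{n,l}(dz)$, one-stage cost $c_n(z_{n,l},i,\zeta)=\int_{\mathcal{S}_{n,l}}c_{\mathcal{K}}(z,i,\zeta)\nu_{n,l}(dz)$, terminal cost $c_T$ restricted to $\Lambda_n\times\mathbb{S}$. Its value functions are $\hat{\mathcal{J}}^n_K=c_T$ on $\Lambda_n\times\mathbb{S}$ and, for $k=K-1,\dots,0$, $(x,i)\in\Lambda_n\times\mathbb{S}$, $$\hat{\mathcal{J}}^n_k(x,i)=\min_{\zeta\in\mathbb{U}}\Big[c_n(x,i,\zeta)+\sum_{(y,j)\in\Lambda_n\times\mathbb{S}}\hat{\mathcal{J}}^n_{k+1}(y,j)\,p_n(y,j\mid x,i,\zeta)\Big].$$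
   Formalization: The minima over actions in the recursions for the value functions are read as infima, since in the finite-state model the minimum need not be attained (its kernel need not be continuous in the action); the two agree whenever the minimum exists. *)

(* Defs.v *)
From HB Require Import structures.
From mathcomp Require Import all_boot all_order all_algebra.
From mathcomp Require Import all_classical all_reals all_analysis.

Set Implicit Arguments.
Unset Strict Implicit.
Unset Printing Implicit Defensive.

Import Order.TTheory GRing.Theory Num.Theory.
Import numFieldNormedType.Exports.

Local Open Scope classical_set_scope.
Local Open Scope ring_scope.

(* Nonempty metric spaces: [measurableType] requires a distinguished point. *)
#[short(type="pmetricType")]
HB.structure Definition PointedMetric (R : numDomainType) :=
  { M of Metric R M & Pointed M }.

(* The finite component S = {1, ..., N.+1}, with the discrete sigma-algebra. *)
HB.instance Definition _ (N : nat) := isPointed.Build 'I_N.+1 ord0.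
HB.instance Definition _ (N : nat) := @isMeasurable.Build
  default_measure_display 'I_N.+1 discrete_measurable discrete_measurable0
  discrete_measurableC discrete_measurableU.

Notation borel T := (g_sigma_algebraType (@open T)).

(* The library norm on ['rV[R]_d] is the sup norm (with the same topology);
   nearest grid points depend on the norm, so the Euclidean one is needed. *)
Definition enorm (R : realType) (d : nat) (x : 'rV[R]_d) : R :=
  Num.sqrt (\sum_(i < d) x ord0 i ^+ 2).

(* Lebesgue measure on R^n, as an iterated product on [n.-tuple R]. *)
Section lebesgue_tuple.
Context {R : realType}.
Local Notation mR := (measurableTypeR R).

Definition tcons n (p : mR * n.-tuple mR) : n.+1.-tuple mR :=
  [the n.+1.-tuple mR of p.1 :: p.2].

Lemma measurable_tcons n : measurable_fun setT (@tcons n).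
Proof. exact: measurable_cons. Qed.

Section step.
Local Open Scope ereal_scope.
Variables (n : nat) (m : {sigma_finite_measure set (n.-tuple mR) -> \bar R}).

Definition lebesgue_step : set (n.+1.-tuple mR) -> \bar R :=
  pushforward (@lebesgue_measure R \x m) (@tcons n).

Let step0 : lebesgue_step set0 = 0.
Proof. by rewrite /lebesgue_step /pushforward preimage_set0 measure0. Qed.

Let step_ge0 A : 0 <= lebesgue_step A.
Proof. by rewrite /lebesgue_step /pushforward; exact: measure_ge0. Qed.

Let step_sigma_additive : semi_sigma_additive lebesgue_step.
Proof.
move=> F mF tF mUF; rewrite /lebesgue_step /pushforward preimage_bigcup.
apply: measure_semi_sigma_additive.
- by move=> k; rewrite -[X in measurable X]setTI; exact: measurable_tcons.
- apply/trivIsetP => /= i j _ _ ij; rewrite -preimage_setI.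
  by move/trivIsetP : tF => /(_ _ _ _ _ ij) ->//; rewrite preimage_set0.
- by rewrite -preimage_bigcup -[X in measurable X]setTI;
    exact: measurable_tcons.
Qed.

HB.instance Definition _ := isMeasure.Build _ _ _ lebesgue_step
  step0 step_ge0 step_sigma_additive.

Let step_sigma_finite : sigma_finite setT lebesgue_step.
Proof.
have /sigma_finiteP[F [FT ndF Foo]] := sigma_finiteT (@lebesgue_measure R).
have /sigma_finiteP[G [GT ndG Goo]] := sigma_finiteT m.
pose g (t : n.+1.-tuple mR) : mR * n.-tuple mR :=
  (thead t, [tuple of behead t]).
have mg : measurable_fun setT g.
  apply/measurable_fun_pairP; split => /=.
    exact: measurable_tnth.
  exact: measurable_behead.
exists (fun k => g @^-1` (F k `*` G k)).
  rewrite -preimage_bigcup predeqE => t; split=> // _.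
  have [i _ Fi] : (\bigcup_i F i) (g t).1 by rewrite -FT.
  have [j _ Gj] : (\bigcup_i G i) (g t).2 by rewrite -GT.
  exists (maxn i j) => //; split.
    by move: Fi; exact/subsetPset/ndF/leq_maxl.
  by move: Gj; exact/subsetPset/ndG/leq_maxr.
move=> k; have [mF Fk] := Foo k; have [mG Gk] := Goo k; split.
  by rewrite -[X in measurable X]setTI; apply: mg => //; exact: measurableX.
rewrite /lebesgue_step /pushforward -comp_preimage.
rewrite (_ : g \o @tcons n = id).
  by rewrite product_measure1E// lte_mul_pinfty// ge0_fin_numE.
by apply/funext => -[x t]; congr pair; exact/val_inj.
Qed.

HB.instance Definition _ := Measure_isSigmaFinite.Build _ _ _ lebesgue_step
  step_sigma_finite.

End step.

Fixpoint lebesgue_tuple n : {sigma_finite_measure set (n.-tuple mR) -> \bar R} :=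
  match n with
  | 0 => \d_([tuple] : 0.-tuple mR)
  | k.+1 => lebesgue_step (lebesgue_tuple k)
  end.

Lemma lebesgue_tuple_box n (A : 'I_n -> set mR) :
    (forall i, measurable (A i)) ->
  lebesgue_tuple n [set t | forall i, A i (tnth t i)] =
    (\prod_(i < n) lebesgue_measure (A i))%E.
Proof.
elim: n A => [|n IHn] A mA.
  by rewrite big_ord0 /= diracE mem_set// => -[].
rewrite big_ord_recl -IHn// /= /lebesgue_step /pushforward.
rewrite -product_measure1E//; last first.
  rewrite (_ : [set t | _] = \bigcap_(i in [set: 'I_n])
      ((fun t : n.-tuple mR => tnth t i) @^-1` A (lift ord0 i))); last first.
    by apply/seteqP; split=> t /= + i; [move=> At _|move=> /(_ i I)]; exact.
  apply: fin_bigcap_measurable => //= i _.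
  by rewrite -[X in measurable X]setTI; apply: measurable_tnth.
congr (product_measure1 _ _ _); apply/seteqP; split=> -[x t] /=.
  move=> At; split=> [|i]; first exact: (At ord0).
  by have := At (lift ord0 i); rewrite tnthS.
move=> [Ax At] i; case: (unliftP ord0 i) => [j ->|->//].
by rewrite tnthS; exact: At.
Qed.

End lebesgue_tuple.

Section sobolev.
Variables (R : realType) (d : nat).
Implicit Types (f g phi : 'rV[R]_d -> R) (s : seq 'I_d).

Definition row_of_tuple (t : d.-tuple (measurableTypeR R)) : 'rV[R]_d :=
  \row_(i < d) tnth t i.

Definition partials s f : 'rV[R]_d -> R :=
  foldr (fun i h => fun x => 'D_(delta_mx ord0 i) h x) f s.

(* C_c^oo(R^d) *)
Definition test_function phi : Prop :=
  [/\ forall s i x, derivable (partials s phi) x (delta_mx ord0 i),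
      forall s, continuous (partials s phi) &
      compact (closure [set x | phi x != 0])].

Definition Lploc (q : R) f : Prop :=
  measurable_fun setT (f \o row_of_tuple) /\
  forall C : set 'rV[R]_d, compact C ->
    (\int[lebesgue_tuple d]_(t in row_of_tuple @^-1` C)
      (`|f (row_of_tuple t)| `^ q)%:E < +oo)%E.

Definition weak_partial s f g : Prop :=
  forall phi, test_function phi ->
    \int[lebesgue_tuple d]_t (f (row_of_tuple t) * partials s phi (row_of_tuple t))
    = (-1) ^+ size s *
      \int[lebesgue_tuple d]_t (g (row_of_tuple t) * phi (row_of_tuple t)).

(* W^{k,q}_loc(R^d) *)
Definition sobolev_loc (k : nat) (q : R) f : Prop :=
  Lploc q f /\
  forall s, (size s <= k)%N -> exists2 g, Lploc q g & weak_partial s f g.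

End sobolev.

(* The Bellman operators below take [inf] over the actions. It is the minimum
   whenever a minimum exists; in the finite models it need not exist, since the
   averaged kernel p_n need not be continuous in the action. *)
Lemma inf_minimum (R : realType) (A : set R) (m : R) :
  A m -> lbound A m -> inf A = m.
Proof.
move=> Am lbm; apply/eqP; rewrite eq_le; apply/andP; split.
  by apply: ge_inf => //; exists m.
by apply: lb_le_inf => //; exists m.
Qed.

Section mdp.
Variables (R : realType) (d N : nat) (U : pmetricType R).
Local Notation X := (borel 'rV[R]_d).
Local Notation S := 'I_N.+1.

(* The kernel lives on the ambient spaces, K being a Borel subset; only its
   restriction to K * S * U matters below. *)
Variable p : R.-pker ((X * S) * borel U)%type ~> (X * S)%type.
Variables (c : 'rV[R]_d -> S -> U -> R) (cT : 'rV[R]_d -> S -> R).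
Variable K : set 'rV[R]_d.

Definition kernel_on : Prop :=
  forall x i z, K x -> p (x, i, z) (K `*` setT) = 1%E.

(* Continuous functions on the compact set K * S are automatically bounded. *)
Definition weakly_continuous : Prop :=
  forall (i : S) (x_ : nat -> 'rV[R]_d) (x : 'rV[R]_d) (z_ : nat -> U) (z : U),
    (forall m, K (x_ m)) -> K x ->
    x_ @ \oo --> x -> z_ @ \oo --> z ->
    forall f : 'rV[R]_d -> S -> R,
      (forall j, {within K, continuous (f ^~ j)}) ->
      (\int[p (x_ m, i, z_ m)]_(y in K `*` setT) f y.1 y.2) @[m --> \oo]
        --> \int[p (x, i, z)]_(y in K `*` setT) f y.1 y.2.

Definition continuous_cost : Prop :=
  forall i, {within K `*` [set: U], continuous (fun xz => c xz.1 i xz.2)}.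

Definition bellman (V : 'rV[R]_d -> S -> R) (x : 'rV[R]_d) (i : S) : R :=
  inf [set c x i z + \int[p (x, i, z)]_(y in K `*` setT) V y.1 y.2
      | z in [set: U]].

(* Value at stage k of the problem with horizon T (for k <= T). *)
Definition Jbar (T k : nat) : 'rV[R]_d -> S -> R := iter (T - k) bellman cT.

Section finite_model.
Variables (L : seq 'rV[R]_d) (nu : probability X R).

Definition quantizer (x : 'rV[R]_d) : 'rV[R]_d :=
  nth 0 L (find (fun y => all (fun y' => enorm (x - y) <= enorm (x - y')) L) L).

Definition cell (y : 'rV[R]_d) : set 'rV[R]_d :=
  [set x | K x /\ quantizer x = y].

Lemma cell_mass_inv_ge0 (y : 'rV[R]_d) : 0 <= (fine (nu (cell y)))^-1.
Proof. by rewrite invr_ge0 fine_ge0. Qed.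

Definition nu_cell (y : 'rV[R]_d) : {measure set X -> \bar R} :=
  mscale (NngNum (cell_mass_inv_ge0 y)) nu.

Definition p_hat (y : 'rV[R]_d) (j : S) (x : 'rV[R]_d) (i : S) (z : U) : R :=
  \int[nu_cell x]_(w in cell x) fine (p (w, i, z) (cell y `*` [set j])).

Definition c_hat (x : 'rV[R]_d) (i : S) (z : U) : R :=
  \int[nu_cell x]_(w in cell x) c w i z.

Definition bellman_hat (V : 'rV[R]_d -> S -> R) (x : 'rV[R]_d) (i : S) : R :=
  inf [set c_hat x i z + \sum_(y <- L) \sum_(j < N.+1) V y j * p_hat y j x i z
      | z in [set: U]].

(* Only meaningful at the points of L; see [Jhat]. *)
Definition Jhat_grid (T k : nat) : 'rV[R]_d -> S -> R :=
  iter (T - k) bellman_hat cT.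

Definition Jhat (T k : nat) (x : 'rV[R]_d) (i : S) : R :=
  Jhat_grid T k (quantizer x) i.

End finite_model.
End mdp.

(* Main.v *)
(** By backward induction every [Jbar_k] is continuous on [K], so the action value
    [c + \int Jbar_(k+1) dp] is jointly continuous on [K * S * U] and, by
    compactness, continuous in the state uniformly in the action. On the grid,
    averaging the one-stage cost and the kernel over a cell amounts to averaging
    [c + \int (Jhat_(k+1) \o Q_n) dp] over that cell, whose points are within
    [2/n] of each other. Hence the error at stage [k] is at most the error at
    stage [k+1] plus the modulus of continuity of the action value at [2/n];
    infima over actions inherit such bounds, attained or not. *)
Require Import Defs.
From HB Require Import structures.
From mathcomp Require Import all_boot all_order all_algebra.
From mathcomp Require Import all_classical all_reals all_analysis.
From mathcomp Require Import measurable_realfun lra.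

Set Implicit Arguments.
Unset Strict Implicit.
Unset Printing Implicit Defensive.

Import Order.TTheory GRing.Theory Num.Theory.
Import numFieldNormedType.Exports.

Local Open Scope classical_set_scope.
Local Open Scope ring_scope.

(** * Infima of uniformly close functions *)

(** An infimum is monotone and commutes with adding [e], so no minimizer is involved. The
    real-valued [inf] is meaningful only on sets bounded below; the bound [m] on [g] passes to [f]
    as [m - e]. *)
Lemma inf_range_close (R : realType) (I : pointedType) (f g : I -> R)
    (m e : R) :
    (forall z, m <= g z) -> (forall z, `|f z - g z| <= e) ->
  `|inf [set f z | z in setT] - inf [set g z | z in setT]| <= e.
Proof.
move=> gm fg.
have fgz z : f z <= g z + e /\ g z <= f z + e.
  by have := fg z; rewrite ler_norml => /andP[? ?]; split; lra.
have hg : has_lbound [set g z | z in setT].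
  by exists m => _ [z _ <-].
have hf : has_lbound [set f z | z in setT].
  exists (m - e) => _ [z _ <-]; have [_ ?] := fgz z; have := gm z; lra.
have ne (h : I -> R) : [set h z | z in setT] !=set0 by exists (h point), point.
have infle (h1 h2 : I -> R) : has_lbound [set h1 z | z in setT] ->
    (forall z, h1 z <= h2 z + e) ->
    inf [set h1 z | z in setT] <= inf [set h2 z | z in setT] + e.
  move=> h1l h12; rewrite -lerBlDr; apply: lb_le_inf => // _ [z _ <-].
  rewrite lerBlDr; apply: le_trans (h12 z); apply: ge_inf => //; by exists z.
have := infle f g hf (fun z => (fgz z).1).
have := infle g f hg (fun z => (fgz z).2).
rewrite ler_norml; lra.
Qed.

(** * Integrals over a set of mass one *)

Section Rintegral_mass1.
Context d (T : measurableType d) (R : realType) (mu : {measure set T -> \bar R}).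
Variable D : set T.
Hypotheses (mD : measurable D) (muD : mu D = 1%E).

Lemma bounded_integrable (f : T -> R) (B : R) :
    measurable_fun D f -> (forall x, D x -> `|f x| <= B) ->
  mu.-integrable D (EFin \o f).
Proof.
move=> mf fB; apply: measurable_bounded_integrable => //.
  by rewrite muD ltry.
exists B; split; first exact: num_real.
by move=> x Bx y Dy /=; rewrite (le_trans (fB _ Dy))// ltW.
Qed.

(** Since [D] has mass one, the constants [e] and [- e] integrate to themselves, and they enclose
    the integral of the difference. *)
Lemma Rintegral_close (f g : T -> R) (e : R) :
    mu.-integrable D (EFin \o f) -> mu.-integrable D (EFin \o g) ->
    (forall x, D x -> `|f x - g x| <= e) ->
  `|\int[mu]_(x in D) f x - \int[mu]_(x in D) g x| <= e.
Proof.
move=> fi gi fg.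
have ci a : mu.-integrable D (EFin \o cst a).
  by apply: (@bounded_integrable _ `|a|) => //; exact: measurable_cst.
rewrite -RintegralB//.
have fgi : mu.-integrable D (EFin \o (fun x => f x - g x)).
  exact: (integrableB mD fi gi).
have cst a : \int[mu]_(x in D) a = a by rewrite Rintegral_cst// muD mulr1.
rewrite ler_norml -{1}(cst (- e)) -{2}(cst e).
apply/andP; split; apply: le_Rintegral => //; try exact: ci.
  by move=> x /fg; rewrite ler_norml => /andP[].
by move=> x /fg; rewrite ler_norml => /andP[].
Qed.

Lemma Rintegral_close_cst (f : T -> R) (a e : R) :
    mu.-integrable D (EFin \o f) -> (forall x, D x -> `|f x - a| <= e) ->
  `|\int[mu]_(x in D) f x - a| <= e.
Proof.
(* Writing [a] as [a] times the mass of [D] turns it into the integral of a constant function. *)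
move=> fi fa; rewrite -[a in X in X <= _](mulr1 a) -[1](congr1 fine muD).
rewrite -Rintegral_cst//; apply: Rintegral_close => //.
by apply: (@bounded_integrable _ `|a|) => //; exact: measurable_cst.
Qed.

Lemma integrable_sumr (I : Type) (s : seq I) (h : I -> T -> R) :
    (forall i, mu.-integrable D (EFin \o h i)) ->
  mu.-integrable D (EFin \o (fun x => \sum_(i <- s) h i x)).
Proof.
move=> hi; rewrite (_ : _ \o _ = (fun x => \sum_(i <- s) (h i x)%:E)%E).
  by apply: integrable_sum => // i _; exact: hi.
by apply/funext => x /=; rewrite sumEFin.
Qed.

Lemma Rintegral_sum (I : Type) (s : seq I) (h : I -> T -> R) :
    (forall i, mu.-integrable D (EFin \o h i)) ->
  \int[mu]_(x in D) (\sum_(i <- s) h i x)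
  = \sum_(i <- s) \int[mu]_(x in D) h i x.
Proof.
move=> hi; elim: s => [|i s IH].
  rewrite big_nil; under eq_Rintegral do rewrite big_nil.
  by rewrite Rintegral_cst// mul0r.
rewrite big_cons -IH -RintegralD//; last exact: integrable_sumr.
by apply: eq_Rintegral => x _; rewrite big_cons.
Qed.

End Rintegral_mass1.

(** * Borel measurability of continuous functions and of functions on a product with a finite set *)

Section borel_measurability.
Context (R : realType) (T : ptopologicalType).

Lemma borel_open (A : set T) : open A -> measurable (A : set (borel T)).
Proof. by move=> oA; exact: sub_sigma_algebra. Qed.

Lemma borel_closed (A : set T) : closed A -> measurable (A : set (borel T)).
Proof.
move=> cA; rewrite -[A]setCK; apply: measurableC; apply: borel_open.
exact: closed_openC.
Qed.

(** Preimages of open intervals are relatively open in [K], hence traces on [K] of ambient open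
    sets, hence Borel. *)
Lemma within_continuous_measurable (K : set T) (f : T -> R) :
    measurable (K : set (borel T)) -> {within K, continuous f} ->
  measurable_fun (K : set (borel T)) (f : borel T -> R).
Proof.
move=> mK /continuousP cf; apply: (measurability _ (RGenOpens.measurableE R)).
move=> _ [_ [a [b ->] <-]].
have oab : open (`]a, b[%classic : set R) by exact: interval_open.
have /open_subspaceP[V oV VK] := cf _ oab.
by rewrite setIC -VK; apply: measurableI => //; exact: borel_open.
Qed.

End borel_measurability.

(** A preimage is the finite union over the labels [j] of rectangles, each a preimage in one slice
    times a singleton. *)
Lemma measurable_fun_slices d (X : measurableType d) (N : nat) (R : realType)
    (K : set X) (f : X -> 'I_N.+1 -> R) :
    measurable K -> (forall j, measurable_fun K (f ^~ j)) ->
  measurable_fun (K `*` [set: 'I_N.+1]) (fun y => f y.1 y.2).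
Proof.
move=> mK mf _ B mB.
rewrite (_ : _ `&` _ = \bigcup_(j in [set: 'I_N.+1])
    ((K `&` (f ^~ j) @^-1` B) `*` [set j])).
  apply: fin_bigcup_measurable => // j _; apply: measurableX => //.
  exact: mf.
apply/seteqP; split => [[x j] [[/= Kx _] Bx]|[x j] [i _ [[/= Kx Bx] ->]]//].
by exists j.
Qed.

(** * Nearest grid points, the Euclidean norm and measurability of cells *)

(** Ensures that the [find] in [quantizer] succeeds on a nonempty grid, so the default value 0 of
    [nth] is never returned. *)
Lemma seq_argmin (R : realType) (T : eqType) (s : seq T) (f : T -> R) :
  s != [::] -> has (fun y => all (fun y' => f y <= f y') s) s.
Proof.
case: s => // t s _; elim: s t => [t|u s IH t]; first by rewrite /= lexx.
have /hasP[y ys /allP ymin] := IH u.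
have [ty|yt] := leP (f t) (f y); apply/hasP.
  exists t; first exact: mem_head.
  apply/allP => y'; rewrite inE => /predU1P[->//|/ymin]; exact: le_trans.
exists y; first by rewrite inE ys orbT.
by apply/allP => y'; rewrite inE => /predU1P[->|/ymin//]; rewrite ltW.
Qed.

Section enorm.
Context (R : realType) (d : nat).
Implicit Types (x y : 'rV[R]_d) (K : set 'rV[R]_d) (L : seq 'rV[R]_d).

Lemma enorm0 : enorm (0 : 'rV[R]_d) = 0.
Proof.
rewrite /enorm big1 ?sqrtr0// => i _.
by rewrite mxE expr0n.
Qed.

(** Library balls use the sup norm, nearest points the Euclidean norm; this comparison turns the
    Euclidean mesh bound into ball membership. *)
Lemma ler_norm_enorm x : `|x| <= enorm x.
Proof.
rewrite [leLHS]/Num.Def.normr/= mx_normrE.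
apply: (big_ind (fun r => r <= enorm x)) => /=.
- exact: sqrtr_ge0.
- by move=> a b ha hb; rewrite ge_max ha hb.
- move=> [i j] _ /=; rewrite (ord1 i) -sqrtr_sqr ler_sqrt ?sumr_ge0//.
    by rewrite (bigD1 j)//= lerDl sumr_ge0// => k _; exact: sqr_ge0.
  by move=> k _; exact: sqr_ge0.
Qed.

Lemma enorm_continuous : continuous (@enorm R d).
Proof.
have cs : continuous (fun x : 'rV[R]_d => \sum_i x ord0 i ^+ 2).
  apply: continuous_big => [|i _ y]; first exact: add_continuous.
  apply: (@continuous_comp _ _ _ _ (fun r : R => r ^+ 2)).
    exact: coord_continuous.
  exact: exprn_continuous.
move=> x; apply: (continuous_comp (cs x)); exact: sqrt_continuous.
Qed.

Lemma quantizer_mem L x : L != [::] -> quantizer L x \in L.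
Proof.
by move=> /(seq_argmin (fun y => enorm (x - y))) xL; rewrite mem_nth// -has_find.
Qed.

Lemma quantizer_nearest L x y :
  y \in L -> enorm (x - quantizer L x) <= enorm (x - y).
Proof.
move=> yL; have L0 : L != [::] by case: L yL.
have /(nth_find 0)/allP := seq_argmin (fun y => enorm (x - y)) L0.
exact.
Qed.

(** Either the head passes the test, or the search continues in the tail. The test [a] is kept
    abstract because in [quantizer] it refers to the whole grid and must stay fixed while the list
    of candidates shrinks. *)
Lemma measurable_nth_find (s : seq 'rV[R]_d)
    (a : 'rV[R]_d -> 'rV[R]_d -> bool) y :
    (forall t, measurable ([set x | a x t] : set (borel 'rV[R]_d))) ->
  measurable ([set x | nth 0 s (find (a x) s) = y] : set (borel 'rV[R]_d)).
Proof.
move=> ma; elim: s => [|t s IH].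
  have [->|y0] := pselect (y = 0).
    by rewrite (_ : mkset _ = setT); [exact: measurableT|apply/seteqP; split].
  by rewrite (_ : mkset _ = set0)//; apply/seteqP; split => // x /= /esym.
rewrite (_ : mkset _ = ([set x | a x t] `&` [set _ | t = y]) `|`
   (~` [set x | a x t] `&` [set x | nth 0 s (find (a x) s) = y])).
  apply: measurableU; apply: measurableI => //; last exact: measurableC.
  have [->|ty] := pselect (t = y).
    by rewrite (_ : mkset _ = setT); [exact: measurableT|apply/seteqP; split].
  by rewrite (_ : mkset _ = set0)//; apply/seteqP; split.
apply/seteqP; split => x /=; case: (a x t) => /=.
- by left.
- by right.
- by case=> [[]|[]].
- by case=> [[]|[]].
Qed.

Lemma measurable_cell K L y : measurable (K : set (borel 'rV[R]_d)) ->
  measurable (cell K L y : set (borel 'rV[R]_d)).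
Proof.
move=> mK; apply: measurableI => //.
apply: (@measurable_nth_find L (fun x y =>
  all (fun y' => enorm (x - y) <= enorm (x - y')) L)).
(* The test for [t] is a finite intersection of closed sets, one comparison of distances for each
   grid point. *)
move=> t /=; elim: L => [|u s IH] /=.
  by rewrite (_ : mkset _ = setT); [exact: measurableT|apply/seteqP; split].
rewrite (_ : mkset _ = [set x | enorm (x - t) <= enorm (x - u)] `&`
   [set x | all (fun y' => enorm (x - t) <= enorm (x - y')) s]).
  apply: measurableI => //; apply: borel_closed.
  have cE v : continuous (fun x : 'rV[R]_d => enorm (x - v)).
    move=> x; apply: (continuous_comp (f := fun x => x - v)); last first.
      exact: enorm_continuous.
    apply: continuousB; [exact: cvg_id|exact: cst_continuous].
  have cB : continuous (fun x : 'rV[R]_d => enorm (x - u) - enorm (x - t)).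
    move=> x; apply: (@continuousB _ _ _ (fun x => enorm (x - u))
      (fun x => enorm (x - t))); [exact: (cE u x)|exact: (cE t x)].
  rewrite (_ : mkset _ = (fun x => enorm (x - u) - enorm (x - t)) @^-1`
      [set r | 0 <= r]).
    by apply: closed_comp => [x _|]; [exact: cB|exact: closed_ge].
  by apply/seteqP; split => x /=; rewrite subr_ge0.
by apply/seteqP; split => x /= => [/andP[]//|[-> ->]].
Qed.

End enorm.

(** * From sequential continuity to continuity uniform over a compact parameter space *)

Section uniform_in_action.
Context (R : realType) (X Y : pseudoMetricType R) (K : set X) (G : X -> Y -> R).
Hypothesis G_seq_continuous : forall (x_ : nat -> X) x (z_ : nat -> Y) z,
  (forall m, K (x_ m)) -> K x -> x_ @ \oo --> x -> z_ @ \oo --> z ->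
  G (x_ m) (z_ m) @[m --> \oo] --> G x z.

(** Otherwise each radius [1/(m+1)] admits a pair violating the bound; these pairs converge to
    [(x, z)], against sequential continuity. *)
Lemma seq_continuous_ball x z e : K x -> 0 < e ->
  exists2 D, 0 < D & forall w z', K w -> ball x D w -> ball z D z' ->
    `|G w z' - G x z| <= e.
Proof.
move=> Kx e0; apply: contrapT => /forall2NP nD.
have /choice[s sP] : forall m, exists wz : X * Y,
    [/\ K wz.1, ball x m.+1%:R^-1 wz.1, ball z m.+1%:R^-1 wz.2 &
      e < `|G wz.1 wz.2 - G x z|].
  move=> m; have [/negP|/existsNP[w /existsNP[z' ]]] := nD m.+1%:R^-1.
    by rewrite invr_gt0 ltr0n.
  move=> /not_implyP[Kw /not_implyP[bw /not_implyP[bz /negP]]].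
  by rewrite -ltNge => ?; exists (w, z').
have cvg_s (M : pseudoMetricType R) (u : nat -> M) a :
    (forall m, ball a m.+1%:R^-1 (u m)) -> u @ \oo --> a.
  move=> ua; apply/cvg_ballP => r r0; near=> m.
  apply: le_ball (ua m); apply/ltW; near: m.
  by have := near_infty_natSinv_lt (PosNum r0).
have := G_seq_continuous (fun m => let: And4 h _ _ _ := sP m in h) Kx
  (cvg_s _ (fun m => (s m).1) x (fun m => let: And4 _ h _ _ := sP m in h))
  (cvg_s _ (fun m => (s m).2) z (fun m => let: And4 _ _ h _ := sP m in h)).
move=> /cvgrPdist_lt/(_ _ e0)[m _ /(_ m (leqnn m))].
by rewrite /= distrC; have [_ _ _ /lt_trans h/h] := sP m; rewrite ltxx.
Unshelve. all: by end_near. Qed.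

(** A Heine-Cantor argument: the local radii around the points of the compact product are made
    uniform by its near-covering property. *)
Lemma seq_continuous_uniform e : compact K -> compact [set: Y] -> 0 < e ->
  \forall D \near 0^'+, forall x w z, K x -> K w -> ball x D w ->
    `|G w z - G x z| <= e.
Proof.
move=> cK cY e0.
have /compact_near_coveringP cov := compact_setX cK cY.
(* The premise [K q.1] is repeated because the covering neighbourhoods live in the ambient space and
   may leave [K]. *)
have : \forall D \near 0^'+, K `*` [set: Y] `<=` (fun q => K q.1 ->
    forall w, K w -> ball q.1 D w -> `|G w q.2 - G q.1 q.2| <= e).
  apply: cov => -[x z] [/= Kx _].
  (* Half of [e], since the values at [(x', z')] and at [(w, z')] are both compared with the value
     at the centre [(x, z)]. *)
  have [D D0 xD] := @seq_continuous_ball x z _ Kx (divr_gt0 e0 (ltr0n _ 2)).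
  (* Half of [D], so that a point within [D / 2] of [x'] remains within [D] of the centre. *)
  have D20 : 0 < D / 2 by rewrite divr_gt0.
  exists ((ball x (D / 2) `*` ball z (D / 2)), [set r | r < D / 2]).
    split => /=; last exact: nbhs_right_lt.
    exists (ball x (D / 2), ball z (D / 2)) => //=.
    by split; exact: nbhsx_ballx.
  move=> [[x' z'] r] /= [[bx bz]] rD Kx' w Kw bw.
  have bxD : ball x D x' by apply: le_ball bx; lra.
  have bzD : ball z D z' by apply: le_ball bz; lra.
  have bwD : ball x D w.
    by rewrite [D]splitr; apply: ball_triangle bx _; apply: le_ball bw; lra.
  have := xD _ _ Kx' bxD bzD; have := xD _ _ Kw bwD bzD.
  rewrite !ler_norml; lra.
apply: filterS => D KD x w z Kx Kw.
exact: (KD (x, z) (conj Kx I) Kx w Kw).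
Qed.

End uniform_in_action.

(** * Regularity of action values and of the exact Bellman operator *)

Section mdp_approximation.
Variables (R : realType) (d N : nat) (U : pmetricType R).
Local Notation X := (borel 'rV[R]_d).
Local Notation S := 'I_N.+1.
Variable p : R.-pker ((X * S) * borel U)%type ~> (X * S)%type.
Variables (c : 'rV[R]_d -> S -> U -> R) (K : set 'rV[R]_d).
Hypotheses (U_compact : compact [set: U]) (K_compact : compact K).
Hypotheses (p_on_K : kernel_on p K) (p_weakly : weakly_continuous p K).
Hypotheses (c_cont : continuous_cost c K).
Hypothesis c_ge0 : forall x i z, K x -> 0 <= c x i z.
Implicit Types (V W : 'rV[R]_d -> S -> R).

(** The expression whose infimum over [z] is [bellman]. Estimates are proved here, uniformly in the
    action, and then passed to the infimum. *)
Definition action_value V (x : 'rV[R]_d) (i : S) (z : U) : R :=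
  c x i z + \int[p (x, i, z)]_(y in K `*` setT) V y.1 y.2.

(** The induction invariant for the exact value functions. Quantifying over all small [D] lets
    several moduli be combined by intersecting filters. *)
Definition uniformly_continuous_on V := forall e, 0 < e ->
  \forall D \near 0^'+, forall i x w, K x -> K w -> ball x D w ->
    `|V w i - V x i| <= e.

Lemma measurable_K : measurable (K : set X).
Proof.
by apply: borel_closed; apply: compact_closed => //; exact: norm_hausdorff.
Qed.

Lemma measurable_KS : measurable (K `*` [set: S] : set (X * S)).
Proof. by apply: measurableX => //; exact: measurable_K. Qed.

Section uniformly_continuous_value.
Variable V : 'rV[R]_d -> S -> R.
Hypothesis V_unif : uniformly_continuous_on V.

Lemma value_continuous i : {within K, continuous (V ^~ i)}.
Proof.
apply/subspace_continuousP => x Kx; apply/cvgrPdist_le => e e0.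
have /filter_ex[D [D0 DV]] : \forall D \near 0^'+, 0 < D /\
    forall i x w, K x -> K w -> ball x D w -> `|V w i - V x i| <= e.
  by near=> D; split; near: D; [exact: nbhs_right_gt|exact: V_unif].
apply: (@filterS _ _ _ (ball x D)) (nbhsx_ballx x D D0) => w bw Kw.
by rewrite distrC; exact: DV.
Unshelve. all: by end_near. Qed.

Lemma value_measurable :
  measurable_fun (K `*` [set: S] : set (X * S)) (fun y => V y.1 y.2).
Proof.
apply: (@measurable_fun_slices _ X N R K V) => [|j]; first exact: measurable_K.
exact: within_continuous_measurable measurable_K (@value_continuous j).
Qed.

Lemma value_bounded : exists M, forall x i, K x -> `|V x i| <= M.
Proof.
have : \forall M \near +oo, forall i x, K x -> `|V x i| <= M.
  apply: filter_forall => i.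
  have : \forall M \near +oo, forall y, ((V ^~ i) @` K) y -> `|y| <= M.
    exact: compact_bounded (continuous_compact (@value_continuous i) K_compact).
  by apply: filterS => M VM x Kx; apply: VM; exists x.
by move=> /filter_ex[M VM]; exists M => x i; exact: VM.
Qed.

Lemma value_integrable (mu : {measure set (X * S) -> \bar R}) :
  mu (K `*` [set: S]) = 1%E ->
  mu.-integrable (K `*` [set: S]) (EFin \o (fun y => V y.1 y.2)).
Proof.
move=> mu1; have [M VM] := value_bounded.
apply: (@bounded_integrable _ _ _ mu _ measurable_KS mu1 _ M).
  exact: value_measurable.
by move=> [x j] [/= Kx _]; exact: VM.
Qed.

(** The cost is nonnegative and the integral is at least [- M], the kernel having mass one on [K].
    This supplies the lower bound required to compare infima. *)
Lemma action_value_ge : exists m, forall x i z, K x -> m <= action_value V x i z.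
Proof.
have [M VM] := value_bounded; exists (- M) => x i z Kx.
have mu1 := p_on_K i z Kx.
have : `|\int[p (x, i, z)]_(y in K `*` setT) V y.1 y.2 - 0| <= M.
  apply: Rintegral_close_cst => //; first exact: measurable_KS.
    exact: value_integrable.
  by move=> [y j] [/= Ky _]; rewrite subr0; exact: VM.
rewrite subr0 ler_norml /action_value => /andP[? _].
by have := c_ge0 i z Kx; lra.
Qed.

(** Both summands are sequentially continuous in state and action: the cost by assumption, the
    integral by weak continuity applied to the continuous function [V]. Compactness of [K] and of
    the actions then gives uniformity. *)
Lemma action_value_uniform e : 0 < e ->
  \forall D \near 0^'+, forall i x w z, K x -> K w -> ball x D w ->
    `|action_value V w i z - action_value V x i z| <= e.
Proof.
move=> e0; apply: filter_forall => i.
apply: seq_continuous_uniform => // x_ x z_ z Kx_ Kx xx zz.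
apply: cvgD; last by apply: p_weakly => // j; exact: value_continuous.
have /subspace_continuousP/(_ (x, z) (conj Kx I)) cc := @c_cont i.
apply: (@cvg_comp _ _ _ (fun m => (x_ m, z_ m)) _ _ _ _ _ cc).
(* [cc] is a limit within the product of [K] and the actions; every term of the sequence lies there,
   so the restriction can be discharged. *)
move=> A; rewrite /within /= => xzA.
have : \forall m \near \oo, (K `*` [set: U]) (x_ m, z_ m) -> A (x_ m, z_ m).
  exact: (cvg_pair xx zz) xzA.
by apply: filterS => m; apply; split => //; exact: Kx_.
Qed.

Lemma bellman_uniformly_continuous : uniformly_continuous_on (bellman p c K V).
Proof.
move=> e e0; have [m Vm] := action_value_ge.
apply: filterS (action_value_uniform e0) => D VD i x w Kx Kw bw.
apply: (@inf_range_close _ _ _ _ m) => z; first exact: Vm.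
exact: VD.
Qed.

End uniformly_continuous_value.

Lemma cost_continuous i z : {within K, continuous (fun x => c x i z)}.
Proof.
apply/subspace_continuousP => x Kx.
have /subspace_continuousP/(_ (x, z) (conj Kx I)) cc := @c_cont i.
apply: (@cvg_comp _ _ _ (fun w => (w, z)) _ _ _ _ _ cc) => A.
rewrite /within /= => xzA.
have : \forall w \near x, (K `*` [set: U]) (w, z) -> A (w, z).
  exact: (cvg_pair (@cvg_id _ (nbhs x)) (@cvg_cst _ z _ (nbhs x) _)) xzA.
by apply: filterS => w xzw Kw; apply: xzw.
Qed.

Lemma cost_bounded i z : exists M, forall x, K x -> `|c x i z| <= M.
Proof.
have : \forall M \near +oo, forall y, ((fun x => c x i z) @` K) y -> `|y| <= M.
  exact: compact_bounded (continuous_compact (@cost_continuous i z) K_compact).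
by move=> /filter_ex[M cM]; exists M => x Kx; apply: cM; exists x.
Qed.

(** * The finite Bellman operator as an average over cells, and the one-step error *)

Section finite_model_step.
Variables (L : seq 'rV[R]_d) (nu : probability X R).
Hypotheses (L_uniq : uniq L)
  (nu_cell_gt0 : forall y, y \in L -> (0 < nu (cell K L y))%E).

(** Positivity of the mass of the cell makes the inverse in [nu_cell] a genuine normalization. *)
Lemma nu_cell_mass1 y : y \in L -> nu_cell K L nu y (cell K L y) = 1%E.
Proof.
move=> /nu_cell_gt0 nu0; rewrite /nu_cell /= /mscale /=.
have nufin : nu (cell K L y) \is a fin_num.
  by apply: fin_num_measure; exact: measurable_cell measurable_K.
by rewrite -[X in (_ * X)%E]fineK// -EFinM mulVf// gt_eqF// fine_gt0//
  nu0 ltey_eq nufin.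
Qed.

Lemma measurable_cell_slice y (j : S) :
  measurable (cell K L y `*` [set j] : set (X * S)).
Proof.
by apply: measurableX => //; exact: measurable_cell measurable_K.
Qed.

(** The cells partition [K], so only the cell of [x] and the label [i] contribute. The grid points
    are distinct, so that term is counted once. *)
Lemma quantizer_step V x i : L != [::] -> K x ->
  V (quantizer L x) i = \sum_(y <- L) \sum_(j < N.+1)
    V y j * \1_(cell K L y `*` [set j]) (x, i).
Proof.
move=> L0 Kx; have qL := quantizer_mem x L0.
rewrite (bigD1_seq (quantizer L x))//= [X in _ + X]big1 ?addr0; last first.
  move=> y yq; rewrite big1// => j _; rewrite indicE memNset ?mulr0//=.
  by move=> [[_ /= /esym/eqP]]; rewrite (negbTE yq).
rewrite (bigD1 i)//= [X in _ + X]big1 ?addr0; last first.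
  move=> j ji; rewrite indicE memNset ?mulr0//=.
  by move=> [_ /= /esym/eqP]; rewrite (negbTE ji).
by rewrite indicE mem_set ?mulr1.
Qed.

Section step_integral.
Variable mu : {measure set (X * S) -> \bar R}.
Hypotheses (mu1 : mu (K `*` [set: S]) = 1%E) (L0 : L != [::]).

Let indic_integrable y j : mu.-integrable (K `*` [set: S])
  (EFin \o (\1_(cell K L y `*` [set j]) : X * S -> R)).
Proof.
apply: (@bounded_integrable _ _ _ mu _ measurable_KS mu1 _ 1).
  by apply: measurable_indic; exact: measurable_cell_slice.
by move=> q _; rewrite indicE; case: (_ \in _); rewrite /= ?normr1 ?normr0.
Qed.

Let step_integrable V y j : mu.-integrable (K `*` [set: S])
  (EFin \o (fun q : X * S => V y j * \1_(cell K L y `*` [set j]) q)).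
Proof. exact: (integrableZl measurable_KS (V y j) (indic_integrable y j)). Qed.

Let steps_integrable V y : mu.-integrable (K `*` [set: S])
  (EFin \o (fun q : X * S => \sum_(j < N.+1)
    V y j * \1_(cell K L y `*` [set j]) q)).
Proof. by apply: (integrable_sumr measurable_KS) => j; exact: step_integrable. Qed.

Lemma integrable_quantizer V : mu.-integrable (K `*` [set: S])
  (EFin \o (fun y => V (quantizer L y.1) y.2)).
Proof.
apply: (eq_integrable measurable_KS (EFin \o (fun q : X * S =>
    \sum_(y <- L) \sum_(j < N.+1) V y j * \1_(cell K L y `*` [set j]) q))).
  by move=> [x i]; rewrite inE => -[/= Kx _]; rewrite -quantizer_step.
by apply: (integrable_sumr measurable_KS) => y; exact: steps_integrable.
Qed.

(** On [K] the integrand is a finite combination of indicators; integrating it yields the sum of the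
    finite model before averaging over a cell. *)
Lemma Rintegral_quantizer V :
  \int[mu]_(y in K `*` setT) V (quantizer L y.1) y.2 =
  \sum_(y <- L) \sum_(j < N.+1) V y j * fine (mu (cell K L y `*` [set j])).
Proof.
have mKS := measurable_KS.
rewrite (@eq_Rintegral _ _ _ mu _ (fun q : X * S =>
    \sum_(y <- L) \sum_(j < N.+1) V y j * \1_(cell K L y `*` [set j]) q)).
  rewrite Rintegral_sum//.
  apply: eq_bigr => y _; rewrite Rintegral_sum//.
  apply: eq_bigr => j _; rewrite RintegralZl//; congr (_ * _).
  rewrite /Rintegral integral_indic//; last exact: measurable_cell_slice.
  by rewrite setIidl// => -[x i] [/= [Kx _] _].
by move=> [x i]; rewrite inE => -[/= Kx _]; exact: quantizer_step.
Qed.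

End step_integral.

(** [e1] bounds the error already present at the next stage, and [e2] the oscillation of the action
    value over the cell of [x]. *)
Lemma bellman_hat_close V W x i e1 e2 :
    uniformly_continuous_on V -> L != [::] -> K x ->
    (forall y j, K y -> `|V y j - W (quantizer L y) j| <= e1) ->
    (forall w z, K w -> quantizer L w = quantizer L x ->
      `|action_value V w i z - action_value V x i z| <= e2) ->
  `|bellman p c K V x i - bellman_hat p c K L nu W (quantizer L x) i|
    <= e1 + e2.
Proof.
(* The sides are exchanged so that the exact action value takes the role of the function with a
   known lower bound. *)
move=> V_unif L0 Kx VW Vx; rewrite distrC; have [m Vm] := action_value_ge V_unif.
apply: (@inf_range_close _ _ _ _ m) => z; first exact: Vm.
have qL := quantizer_mem x L0.
set C := cell K L (quantizer L x).
set mu := nu_cell K L nu (quantizer L x).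
have mC : measurable (C : set X) by exact: measurable_cell measurable_K.
have mu1 : mu C = 1%E by exact: nu_cell_mass1.
have mA := measurable_cell_slice.
(* Transition probabilities are measurable in the state by the kernel property and bounded by 1,
   hence integrable over the cell. *)
have ip y j : mu.-integrable C
    (EFin \o (fun w => fine (p (w, i, z) (cell K L y `*` [set j])))).
  apply: (@bounded_integrable _ _ _ mu _ mC mu1 _ 1).
    apply: measurable_funTS; apply: measurableT_comp => //.
    apply: (measurableT_comp (measurable_kernel p _ (mA y j))).
    by apply: measurable_fun_pair => //; exact: measurable_fun_pair.
  move=> w _; have p1 : (p (w, i, z) (cell K L y `*` [set j]) <= 1)%E.
    by rewrite -(@prob_kernel _ _ _ _ _ p (w, i, z)); apply: le_measure; rewrite ?inE.
  rewrite ger0_norm ?fine_ge0// -lee_fin fineK//.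
  by rewrite ge0_fin_numE// (le_lt_trans p1)// ltry.
have iWp y j : mu.-integrable C
    (EFin \o (fun w => W y j * fine (p (w, i, z) (cell K L y `*` [set j])))).
  exact: (integrableZl mC (W y j) (ip y j)).
have iWps y : mu.-integrable C (EFin \o (fun w => \sum_(j < N.+1)
    W y j * fine (p (w, i, z) (cell K L y `*` [set j])))).
  by apply: (integrable_sumr mC) => j; exact: iWp.
have iWpss : mu.-integrable C (EFin \o (fun w => \sum_(y <- L) \sum_(j < N.+1)
    W y j * fine (p (w, i, z) (cell K L y `*` [set j])))).
  by apply: (integrable_sumr mC) => y; exact: iWps.
have ic : mu.-integrable C (EFin \o (fun w => c w i z)).
  have [M cM] := cost_bounded i z.
  apply: (@bounded_integrable _ _ _ mu _ mC mu1 _ M) => [|w [Kw _]];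
    last exact: cM.
  apply: (@measurable_funS _ _ X R K) measurable_K _ _; first by move=> w [].
  exact: within_continuous_measurable measurable_K (@cost_continuous i z).
(* Linearity gathers the averaged cost and the averaged kernel into one average over the cell, for a
   fixed action. *)
have -> : c_hat c K L nu (quantizer L x) i z + \sum_(y <- L) \sum_(j < N.+1)
      W y j * p_hat p K L nu y j (quantizer L x) i z =
    \int[mu]_(w in C) (c w i z + \sum_(y <- L) \sum_(j < N.+1)
      W y j * fine (p (w, i, z) (cell K L y `*` [set j]))).
  rewrite RintegralD// Rintegral_sum//; congr (_ + _).
  apply: eq_bigr => y _; rewrite Rintegral_sum//.
  by apply: eq_bigr => j _; rewrite RintegralZl.
(* The average is as close to the exact action value at [x] as its integrand is at each [w] of the
   cell. *)
apply: Rintegral_close_cst => //; first exact: (integrableD mC ic iWpss).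
move=> w [Kw wx]; have p1 := p_on_K i z Kw.
rewrite -Rintegral_quantizer//.
have : `|\int[p (w, i, z)]_(y in K `*` setT) V y.1 y.2 -
    \int[p (w, i, z)]_(y in K `*` setT) W (quantizer L y.1) y.2| <= e1.
  apply: Rintegral_close => //.
  - exact: measurable_KS.
  - exact: value_integrable.
  - exact: integrable_quantizer.
  - by move=> [y j] [/= Ky _]; exact: VW.
have := Vx w z Kw wx; rewrite /action_value !ler_norml; lra.
Qed.

End finite_model_step.
End mdp_approximation.

(** * Mesh estimates and convergence of the value functions *)

Lemma ball_quantizer (R : realType) (d : nat) (L : seq 'rV[R]_d) x y r :
  y \in L -> enorm (x - y) < r -> ball x r (quantizer L x).
Proof.
move=> yL xy; rewrite -ball_normE /=.
exact: le_lt_trans (ler_norm_enorm _) (le_lt_trans (quantizer_nearest x yL) xy).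
Qed.

(** Since [M * enorm v] tends to 0 with [v], small sup-norm balls give small Euclidean Lipschitz
    bounds without an explicit radius. *)
Lemma lipschitz_uniformly_continuous_on (R : realType) (d N : nat)
    (K : set 'rV[R]_d) (V : 'rV[R]_d -> 'I_N.+1 -> R) (M : R) :
    (forall i x y, `|V x i - V y i| <= M * enorm (x - y)) ->
  uniformly_continuous_on K V.
Proof.
move=> VM e e0.
have cM : M * enorm v @[v --> (0 : 'rV[R]_d)] --> (0 : R).
  have c0 : enorm v @[v --> (0 : 'rV[R]_d)] --> (0 : R).
    by rewrite -[X in _ --> X](enorm0 R d); exact: enorm_continuous.
  by rewrite -[X in _ --> X](mulr0 M); exact: (cvgMl_tmp (a := M) c0).
move/cvgrPdist_le : cM => /(_ e e0)/nbhs_ballP[r /= r0 rM].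
near=> D => i x w _ _ xw; rewrite distrC; apply: le_trans (VM i x w) _.
have : ball (0 : 'rV[R]_d) r (x - w).
  move: xw; rewrite -!ball_normE /= sub0r normrN => /lt_le_trans; apply.
  by near: D; exact: nbhs_right_le.
by move=> /rM /=; rewrite sub0r normrN; apply: le_trans; exact: ler_norm.
Unshelve. all: by end_near. Qed.

(** Nonemptiness of [A] keeps the supremum nonnegative instead of minus infinity. The uniform bound
    makes it eventually finite, and convergence is then checked in the reals. *)
Lemma ereal_sup_cvg0 (R : realType) (I : Type) (A : set I) (f : nat -> I -> R) :
    A !=set0 ->
    (forall e, 0 < e -> \forall n \near \oo, forall x, A x -> `|f n x| <= e) ->
  ereal_sup [set `|f n x|%:E | x in A] @[n --> \oo] --> (0 : \bar R)%E.
Proof.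
move=> [a Aa] fe.
have sup_le e : 0 < e -> \forall n \near \oo,
    (0 <= ereal_sup [set `|f n x|%:E | x in A] <= e%:E)%E.
  move=> e0; apply: filterS (fe e e0) => n fn; apply/andP; split.
    apply: ereal_sup_ge; exists `|f n a|%:E; first by exists a.
    by rewrite lee_fin.
  by apply: ge_ereal_sup => _ [x Ax <-]; rewrite lee_fin fn.
have fin e n : (0 <= ereal_sup [set `|f n x|%:E | x in A] <= e%:E)%E ->
    ereal_sup [set `|f n x|%:E | x in A] \is a fin_num.
  by move=> /andP[s0 se]; rewrite ge0_fin_numE// (le_lt_trans se)// ltry.
apply/fine_cvgP; split.
  by apply: filterS (sup_le 1 ltr01) => n; exact: fin.
apply/cvgrPdist_le => e e0; apply: filterS (sup_le e e0) => n /[dup] /fin sfin /=.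
rewrite sub0r normrN; rewrite -(fineK sfin) !lee_fin => /andP[s0 se].
by rewrite ger0_norm.
Qed.

Theorem theorem6p5 (R : realType) (d N : nat)
    (U : pmetricType R) (U_compact : compact [set: U])
    (cT : 'rV[R]_d -> 'I_N.+1 -> R)
    (cT_bounded : exists M : R, forall x i, `|cT x i| <= M)
    (cT_lipschitz : exists M : R, forall i x y,
      `|cT x i - cT y i| <= M * enorm (x - y))
    (cT_sobolev : exists2 q : R, 2 <= q &
      forall i, sobolev_loc 2 q (fun x => cT x i))
    (K : set 'rV[R]_d) (K_compact : compact K)
    (p : R.-pker ((borel 'rV[R]_d * 'I_N.+1) * borel U)%type
           ~> (borel 'rV[R]_d * 'I_N.+1)%type)
    (p_on_K : kernel_on p K)
    (p_weakly_continuous : weakly_continuous p K)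
    (c : 'rV[R]_d -> 'I_N.+1 -> U -> R)
    (c_continuous : continuous_cost c K)
    (c_ge0 : forall x i z, K x -> 0 <= c x i z)
    (T : nat)
    (L : nat -> seq 'rV[R]_d)
    (L_uniq : forall n, (0 < n)%N -> uniq (L n))
    (L_sub : forall n, (0 < n)%N -> forall y, y \in L n -> K y)
    (L_net : forall n, (0 < n)%N -> forall x, K x ->
      exists2 y, y \in L n & enorm (x - y) < n%:R^-1)
    (nu : nat -> probability (borel 'rV[R]_d) R)
    (nu_on_K : forall n, (0 < n)%N -> nu n K = 1%E)
    (nu_cell_gt0 : forall n, (0 < n)%N -> forall y, y \in L n ->
      (0 < nu n (cell K (L n) y))%E)
    (k : nat) (hk : (k <= T)%N) :
  (fun n : nat => ereal_sup
     [set `|Jbar p c cT K T k xi.1 xi.2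
            - Jhat p c cT K (L n) (nu n) T k xi.1 xi.2|%:E
     | xi in K `*` [set: 'I_N.+1]]) @ \oo --> (0 : \bar R)%E.
Proof.
(* The empty set cannot carry the unit mass of [nu 1]; index 1 is the first at which the grid
   hypotheses hold. *)
have [x0 Kx0] : K !=set0.
  apply/set0P/eqP => K0; have := nu_on_K 1%N isT.
  by rewrite K0 measure0 => /eqP; rewrite eqe eq_sym oner_eq0.
have L0 n : (0 < n)%N -> L n != [::].
  by move=> n0; have [y] := L_net n n0 x0 Kx0; case: (L n).
have Jbar_unif m : uniformly_continuous_on K (iter m (bellman p c K) cT).
  elim: m => [|m IH] /=.
    by have [M cTM] := cT_lipschitz; exact: lipschitz_uniformly_continuous_on cTM.
  exact: bellman_uniformly_continuous.
have near_quantizer D : 0 < D -> \forall n \near \oo, (0 < n)%N /\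
    forall x, K x -> ball x D (quantizer (L n) x).
  move=> D0; near=> n.
  have n0 : (0 < n)%N by near: n; exact: nbhs_infty_gt.
  split => // x Kx; have [y yL xy] := L_net n n0 x Kx.
  apply: ball_quantizer yL (lt_trans xy _).
  (* The mesh [1/n] is below [D] as soon as [n] exceeds [1/D]. *)
  rewrite -[D]invrK ltf_pV2 ?posrE ?invr_gt0 ?ltr0n//; near: n.
  exact: nbhs_infty_gtr.
have Jhat_cvg m e : 0 < e -> \forall n \near \oo, forall x i, K x ->
    `|iter m (bellman p c K) cT x i -
      iter m (bellman_hat p c K (L n) (nu n)) cT (quantizer (L n) x) i| <= e.
  (* Induction on the number [m] of stages to go, with [e] general so that the next stage can be
     used at [e / 2]. *)
  elim: m e => [|m IH] e e0.
    have /filter_ex[D [D0 DcT]] : \forall D \near 0^'+, 0 < D /\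
        forall i x w, K x -> K w -> ball x D w -> `|cT w i - cT x i| <= e.
      by near=> D; split; near: D; [exact: nbhs_right_gt|exact: (Jbar_unif 0%N)].
    apply: filterS (near_quantizer D D0) => n [n0 qn] x i Kx.
    rewrite distrC; apply: DcT => //; last exact: qn.
    exact: (L_sub n n0 _ (quantizer_mem x (L0 n n0))).
  have e20 : 0 < e / 2 by rewrite divr_gt0.
  have /filter_ex[D [D0 DV]] : \forall D \near 0^'+, 0 < D /\
      forall i x w z, K x -> K w -> ball x D w ->
      `|action_value p c K (iter m (bellman p c K) cT) w i z -
        action_value p c K (iter m (bellman p c K) cT) x i z| <= e / 2.
    near=> D; split; near: D; first exact: nbhs_right_gt.
    exact: action_value_uniform.
  (* Two points of one cell are each within [D / 2] of their common grid point, hence within [D] of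
     each other. *)
  have D20 : 0 < D / 2 by rewrite divr_gt0.
  apply: filterS2 (near_quantizer _ D20) (IH _ e20) => n [n0 qn] Jn x i Kx.
  rewrite [e]splitr !iterS; apply: bellman_hat_close => //.
  - exact: L_uniq.
  - exact: nu_cell_gt0.
  - exact: L0.
  - move=> w z Kw wx; apply: DV => //; rewrite [D]splitr.
    apply: ball_triangle (qn x Kx) _; apply: ball_sym; rewrite -wx; exact: qn.
apply: (ereal_sup_cvg0 (A := K `*` [set: 'I_N.+1])
  (f := fun n xi => Jbar p c cT K T k xi.1 xi.2
                  - Jhat p c cT K (L n) (nu n) T k xi.1 xi.2)).
  by exists (x0, ord0).
(* At stage [k] of horizon [T] there are [T - k] stages to go. *)
move=> e e0; apply: filterS (Jhat_cvg (T - k)%N e e0) => n Jn [x i] [/= Kx _].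
exact: Jn.
Unshelve. all: by end_near. Qed.
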